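(* Let $\tau$ be a finite nonempty set of proposition symbols and let $d\in\mathbb Z_+$. There is $n_0$ (depending only on $d$ and the fixed vocabulary $\tau$) such that for every $n\ge n_0$: if $\overline n$ and $\overline n'$ are two distinct $\preceq_\tau$-comparable $(n,d)$-admissible tuples, then \[H_B(M_{\overline n})<H_B(M_{\overline n'})\ \Leftrightarrow\ C(M_{\overline n})<C(M_{\overline n'}).\]
   Context: Models: a $\tau$-model with domain $W$ assigns to each $p\in\tau$ a subset of $W$ (the points where $p$ is true). $\mathcal M$ is the set of all $\tau$-models with domain $\{1,\dots,n\}$. A type over $\tau$ is a maximally consistent set of literals ($p$ or $\neg p$, $p\in\tau$); there are $t=2^{|\tau|}$ types, enumerated as $(\pi_i)_{i\in I}$, $I=\{1,\dots,t\}$. Each point of a model realizes exactly one type. Logic: propositional formulas are $\psi ::= p\mid\neg p\mid\psi\wedge\psi\mid\psi\vee\psi$ with $p\in\tau$. Formulas of $\mathrm{GMLU}$ are built from $\diamond^{\ge k}\psi$, $\blacksquare^{<k}\psi$, $\diamond^{=k}\psi$, $\blacksquare^{\ne k}\psi$ ($\psi$ propositional, $k\in\mathbb N$) by closing under $\wedge,\vee$ and under prefixing $\diamond^{\ge k},\blacksquare^{<k},\diamond^{=k},\blacksquare^{\ne k}$. Semantics at a point $w$: Boolean connectives as usual; $\diamond^{\ge k}\varphi$ (resp. $\diamond^{=k}\varphi$) holds iff at least (resp. exactly) $k$ points of the domain satisfy $\varphi$; $\blacksquare^{<k}\varphi$ is equivalent to $\neg\diamond^{\ge k}\neg\varphi$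 and $\blacksquare^{\ne k}\varphi$ to $\neg\diamond^{=k}\neg\varphi$. Truth of a $\mathrm{GMLU}$-formula in a model does not depend on the point, so $\mathfrak M\vDash\varphi$ is well defined. $\mathrm{GMLU}_d$ is the set of formulas of counting depth at most $d$, i.e. in which every occurring $\diamond^{\ge k},\blacksquare^{<k}$ has $k\le d$ and every occurring $\diamond^{=k},\blacksquare^{\ne k}$ has $k+1\le d$. Size: literals have size $1$; $\mathrm{size}(\varphi\wedge\psi)=\mathrm{size}(\varphi\vee\psi)=\mathrm{size}(\varphi)+\mathrm{size}(\psi)+1$; $\mathrm{size}(\diamond^{\ge k}\varphi)=\mathrm{size}(\blacksquare^{<k}\varphi)=\mathrm{size}(\varphi)+k$; $\mathrm{size}(\diamond^{=k}\varphi)=\mathrm{size}(\blacksquare^{\ne k}\varphi)=\mathrm{size}(\varphi)+k+1$. A formula $\varphi$ defines $M\subseteq\mathcal M$ if for all $\mathfrak M\in\mathcal M$: $\mathfrak M\vDash\varphi\Leftrightarrow\mathfrak M\in M$. $C(M)$ is the minimum size of a $\mathrm{GMLU}_d$-formula defining $M$. Classes: $\mathfrak M\equiv_d\mathfrak N$ iff $\mathfrak M,\mathfrak N\in\mathcal M$ satisfy the same $\mathrm{GMLU}_d$-formulas. A tuple $\overline n=(n_i)_{i\in I}$ of natural numbers is $(n,d)$-admissible if $n_i\le d$ for all $i$, $\sum_i n_i\le n$, and either some $n_i=d$ or $\sum_i n_i=n$. $M_{\overline n}$ is the set of models in $\mathcal M$ having exactly $n_i$ points of type $\pi_i$ whenever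 $n_i<d$ and at least $d$ points of type $\pi_i$ whenever $n_i=d$; the map $\overline n\mapsto M_{\overline n}$ is a bijection from $(n,d)$-admissible tuples to equivalence classes of $\equiv_d$. The Boltzmann entropy of a class $M$ is $H_B(M)=\log_2|M|$. Order: with $c_\tau:=2^{|\tau|}(2|\tau|+1)-1$, $\overline n\preceq_\tau\overline n'$ iff $n_i\le n_i'$ for every $i\in I$ and, moreover, either $\overline n=\overline n'$ or $\sum_{i\in I}(n_i'-n_i)>c_\tau$. *)

(* Defs.v *)
From HB Require Import structures.
From mathcomp Require Import all_boot all_order all_algebra.
From mathcomp Require Import boolp reals exp.

Set Implicit Arguments.
Unset Strict Implicit.
Unset Printing Implicit Defensive.

Import Order.TTheory GRing.Theory Num.Theory.

(* The domain {1, ..., n} is represented by 'I_n. *)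
Definition model (tau : finType) (n : nat) := {ffun tau -> {set 'I_n}}.

(* A maximally consistent set of literals contains exactly one of p and ~ p for
   each p; it is encoded by the function mapping p to true iff p is the member.
   These functions also serve as the index set I of the enumeration of types. *)
Definition ptype (tau : finType) := {ffun tau -> bool}.

Definition type_of (tau : finType) (n : nat) (M : model tau n) (w : 'I_n) :
  ptype tau := [ffun p => w \in M p].

Definition realizers (tau : finType) (n : nat) (M : model tau n)
  (pi : ptype tau) : {set 'I_n} := [set w | type_of M w == pi].

Inductive prop_form (tau : finType) : Type :=
| PPos of tau
| PNeg of tau
| PAnd of prop_form tau & prop_form tau
| POr of prop_form tau & prop_form tau.

(* The prefixes diamond^{>= k}, box^{< k}, diamond^{= k}, box^{<> k}. *)
Inductive modality : Type :=
| DiamondGe of nat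
| BoxLt of nat
| DiamondEq of nat
| BoxNe of nat.

Inductive gmlu (tau : finType) : Type :=
| GBase of modality & prop_form tau
| GAnd of gmlu tau & gmlu tau
| GOr of gmlu tau & gmlu tau
| GMod of modality & gmlu tau.

Fixpoint prop_sat (tau : finType) (n : nat) (M : model tau n) (w : 'I_n)
  (psi : prop_form tau) : bool :=
  match psi with
  | PPos p => w \in M p
  | PNeg p => w \notin M p
  | PAnd a b => prop_sat M w a && prop_sat M w b
  | POr a b => prop_sat M w a || prop_sat M w b
  end.

(* S is the set of points satisfying the formula under the prefix. *)
Definition modality_sat (n : nat) (q : modality) (S : {set 'I_n}) : bool :=
  match q with
  | DiamondGe k => k <= #|S|
  | BoxLt k => ~~ (k <= #|~: S|)
  | DiamondEq k => #|S| == k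
  | BoxNe k => ~~ (#|~: S| == k)
  end.

Fixpoint gmlu_sat (tau : finType) (n : nat) (M : model tau n) (w : 'I_n)
  (phi : gmlu tau) : bool :=
  match phi with
  | GBase q psi => modality_sat q [set v | prop_sat M v psi]
  | GAnd a b => gmlu_sat M w a && gmlu_sat M w b
  | GOr a b => gmlu_sat M w a || gmlu_sat M w b
  | GMod q a => modality_sat q [set v | gmlu_sat M v a]
  end.

(* The truth value at w does not depend on w, so for n > 0 this agrees with truth
   at an arbitrary point. *)
Definition models (tau : finType) (n : nat) (M : model tau n) (phi : gmlu tau) :
  bool := [forall w, gmlu_sat M w phi].

(* The contribution of a prefix to the size, which is also the quantity bounded
   by the counting depth. *)
Definition modality_cost (q : modality) : nat :=
  match q with
  | DiamondGe k | BoxLt k => k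
  | DiamondEq k | BoxNe k => k.+1
  end.

Fixpoint prop_size (tau : finType) (psi : prop_form tau) : nat :=
  match psi with
  | PPos _ | PNeg _ => 1
  | PAnd a b | POr a b => prop_size a + prop_size b + 1
  end.

Fixpoint gmlu_size (tau : finType) (phi : gmlu tau) : nat :=
  match phi with
  | GBase q psi => prop_size psi + modality_cost q
  | GAnd a b | GOr a b => gmlu_size a + gmlu_size b + 1
  | GMod q a => gmlu_size a + modality_cost q
  end.

Fixpoint in_gmlu_d (d : nat) (tau : finType) (phi : gmlu tau) : bool :=
  match phi with
  | GBase q _ => modality_cost q <= d
  | GAnd a b | GOr a b => in_gmlu_d d a && in_gmlu_d d b
  | GMod q a => (modality_cost q <= d) && in_gmlu_d d a
  end.

Definition defines (tau : finType) (n : nat) (phi : gmlu tau)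
  (A : {set model tau n}) : Prop :=
  forall M : model tau n, models M phi <-> M \in A.

Definition definable_in_size (tau : finType) (n d : nat)
  (A : {set model tau n}) (s : nat) : Prop :=
  exists phi : gmlu tau, [/\ in_gmlu_d d phi, defines phi A & gmlu_size phi = s].

(* C(A); the value 0 is taken when no formula of GMLU_d defines A, and only then
   since every formula has positive size. *)
Definition description_complexity (tau : finType) (n d : nat)
  (A : {set model tau n}) : nat :=
  match pselect (exists s, `[< definable_in_size d A s >]) with
  | left ex => ex_minn ex
  | right _ => 0
  end.

Definition admissible (tau : finType) (n d : nat) (nb : {ffun ptype tau -> nat}) :
  Prop :=
  [/\ forall i, nb i <= d,
      \sum_i nb i <= n
    & (exists i, nb i = d) \/ \sum_i nb i = n].

Definition class_of (tau : finType) (n d : nat) (nb : {ffun ptype tau -> nat}) :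
  {set model tau n} :=
  [set M : model tau n | [forall i : ptype tau,
     if nb i < d then #|realizers M i| == nb i else d <= #|realizers M i| ]].

Definition boltzmann_entropy (R : realType) (tau : finType) (n : nat)
  (A : {set model tau n}) : R :=
  (ln (#|A|%:R : R) / ln (2%:R : R))%R.

Definition c_tau (tau : finType) : nat := 2 ^ #|tau| * (2 * #|tau| + 1) - 1.

(* The truncated differences are exact because of the first conjunct. *)
Definition preceq_tau (tau : finType) (nb nb' : {ffun ptype tau -> nat}) : Prop :=
  (forall i, nb i <= nb' i) /\
  (nb = nb' \/ c_tau tau < \sum_i (nb' i - nb i)).

(* Main.v *)
Require Import Defs.
From mathcomp Require Import all_boot all_order all_algebra.
From mathcomp Require Import boolp reals exp.
From mathcomp Require Import zify.

Set Implicit Arguments.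
Unset Strict Implicit.
Unset Printing Implicit Defensive.

Import Order.TTheory GRing.Theory Num.Theory.

(** Write [t] for the number of types and let [n > 2dt].  An admissible tuple then
has a coordinate equal to [d], since otherwise its entries would have to sum to
[n].  For two tuples with [nb <= nb'] pointwise and a gap of more than [c_tau]
between their sums, both the entropy and the description complexity are strictly
larger for [nb']; as distinct comparable tuples are in this situation in one of
the two directions, the equivalence follows.

Entropy.  It suffices to raise one coordinate [i] by one.  In a model of the
smaller class at least [n - dt] points have a type with more than [d] realizers,
and giving any of them the type [i] yields a model of the larger class.  In the
reverse direction the changed point is one of at most [d] realizers of [i], and
its old type is one of [t].  So the smaller class times [n - dt] is at most the
larger class times [dt], and [n - dt > dt] ([card_class_of_step],
[card_class_of_lt]).

Complexity.  The size is governed by the sum of [nb] not over all types but over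
the essential ones, those [i] for which some other coordinate equals [d].  An
inessential [i] can only occur as the unique coordinate equal to [d]; its points
are all those left over when the other types are counted exactly, so a formula
need not mention it.  Conjoining one counting formula per essential type costs at
most this essential sum plus [c_tau] ([definable_upper_bound]), and the essential
sum is itself a lower bound ([size_lower_bound]).  From [nb] to [nb'] the
essential sum grows by at least the difference of the full sums
([essential_sum_gap]), which exceeds [c_tau].

The lower bound rests on [separating_atom].  Take the model of the class with
exactly [nb k] points of each type [k] except one type [j] with [nb j = d], which
takes all remaining points, and move one point from [i] to [j].  The new model is
outside the class, so some innermost counting statement of the formula changes
its value.  Counting up to [d] cannot see a change among the many points of type
[j], so that statement counts a set of types that avoids [j] and contains [i], and
its cost is at least the total of [nb] over that set.  Summing over all [i] other
than [j] pays for every type but [j]; if [j] is essential, exchanging its role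
with another coordinate equal to [d] gives a further statement that counts [j],
which is not among those already charged. *)

(** * Counts of realizers *)

Lemma realizersE (tau : finType) (n : nat) (M : model tau n) i w :
  (w \in realizers M i) = (type_of M w == i).
Proof. by rewrite inE. Qed.

Lemma model_eqP (tau : finType) (n : nat) (M N : model tau n) :
  type_of M =1 type_of N -> M = N.
Proof.
move=> eqMN; apply/ffunP => p; apply/setP => w.
by have /ffunP/(_ p) := eqMN w; rewrite !ffunE.
Qed.

Lemma card_type_pred (tau : finType) (n : nat) (M : model tau n)
    (P : pred (ptype tau)) :
  #|[set w | P (type_of M w)]| = \sum_(i | P i) #|realizers M i|.
Proof.
rewrite -sum1_card (partition_big (type_of M) P) /=; last by move=> w; rewrite inE.
apply: eq_bigr => i Pi; rewrite -sum1_card; apply: eq_bigl => w.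
by rewrite !inE; case: eqP => [->|]; rewrite ?Pi ?andbF.
Qed.

Lemma sum_realizers (tau : finType) (n : nat) (M : model tau n) :
  \sum_i #|realizers M i| = n.
Proof.
rewrite -(card_type_pred M predT) -[RHS](card_ord n).
by apply: eq_card => w; rewrite !inE.
Qed.

(** Membership in a class and the truth of atoms depend on a model only through
its counts of realizers, so witnesses are specified by their counts alone. *)
Lemma model_with_counts (tau : finType) (n : nat) (m : ptype tau -> nat) :
  \sum_i m i = n -> exists M : model tau n, forall i, #|realizers M i| = m i.
Proof.
move=> sum_m; pose s := flatten [seq nseq (m i) i | i <- enum {: ptype tau}].
have size_s : size s = n.
  rewrite size_flatten sumnE 2!big_map -sum_m big_enum /=.
  by apply: eq_bigr => i _; rewrite size_nseq.
pose x0 : ptype tau := [ffun=> true].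
exists [ffun p => [set w : 'I_n | nth x0 s w p]] => i.
have -> : m i = count_mem i s.
  rewrite count_flatten sumnE 2!big_map big_enum /= (bigD1 i) //= big1 => [|k ki].
    by rewrite count_nseq /= eqxx mul1n addn0.
  by rewrite count_nseq /= (negbTE ki).
rewrite -sum1_card -sum1_count (big_nth x0) size_s big_mkord.
apply: eq_bigl => w; rewrite realizersE; congr (_ == _).
by apply/ffunP => p; rewrite !ffunE inE.
Qed.

(** Truncating at [d] replaces the case distinction in the definition of the class
by a single equation. *)
Lemma in_class_of (tau : finType) (n d : nat) (nb : {ffun ptype tau -> nat})
    (M : model tau n) : (forall i, nb i <= d) ->
  M \in class_of n d nb = [forall i, minn #|realizers M i| d == nb i].
Proof.
move=> nb_le; rewrite inE; apply: eq_forallb => i; have := nb_le i.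
by case: ltnP; lia.
Qed.

Lemma sum_le_dt (tau : finType) (d : nat) (nb : ptype tau -> nat) :
  (forall i, nb i <= d) -> \sum_i nb i <= d * #|ptype tau|.
Proof.
move=> nb_le; rewrite -[leqRHS]mulnC -sum_nat_const.
by apply: leq_sum => i _; apply: nb_le.
Qed.

(** The counts in which every type other than [j] has as few points as the class
allows. *)
Definition concentrated (tau : finType) (n : nat) (nb : ptype tau -> nat)
    (j : ptype tau) : ptype tau -> nat :=
  fun l => if l == j then n - \sum_(k | k != j) nb k else nb l.

Lemma sum_concentrated (tau : finType) (n : nat) (nb : ptype tau -> nat) j :
  \sum_i nb i <= n -> \sum_i concentrated n nb j i = n.
Proof.
rewrite (bigD1 j) // [in X in _ -> X](bigD1 j) //= => le_n.
have -> : \sum_(k | k != j) concentrated n nb j k = \sum_(k | k != j) nb k.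
  by apply: eq_bigr => k /negbTE kj; rewrite /concentrated kj.
by rewrite /concentrated eqxx subnK //; apply: leq_trans le_n; apply: leq_addl.
Qed.

Lemma class_of_gt0 (tau : finType) (n d : nat) (nb : {ffun ptype tau -> nat}) j :
  (forall i, nb i <= d) -> nb j = d -> d * #|ptype tau| <= n ->
  0 < #|class_of n d nb|.
Proof.
move=> nb_le nbj n_ge; have sum_le := leq_trans (sum_le_dt nb_le) n_ge.
have [M cM] := model_with_counts (sum_concentrated j sum_le).
apply/card_gt0P; exists M; rewrite in_class_of //; apply/forallP => i.
rewrite cM /concentrated; have [->|_] := eqVneq i j.
  rewrite nbj; move: sum_le; rewrite (bigD1 j) //= nbj.
  by move: (\sum_(_ | _) _) => r; lia.
by have := nb_le i; lia.
Qed.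

(** * Entropy *)

Definition retype (tau : finType) (n : nat) (M : model tau n) (w : 'I_n)
    (i : ptype tau) : model tau n :=
  [ffun p => if i p then w |: M p else M p :\ w].

Lemma type_of_retype (tau : finType) (n : nat) (M : model tau n) w i v :
  type_of (retype M w i) v = if v == w then i else type_of M v.
Proof.
apply/ffunP => p; rewrite !ffunE; case: ifP => ip; rewrite !inE.
  by case: eqP => //= _; rewrite ffunE.
by case: eqP => //= _; rewrite ffunE.
Qed.

(** Retyping loses nothing if the point and its old type are remembered, which is
what makes the map in [card_class_of_step] injective. *)
Lemma retypeK (tau : finType) (n : nat) (M : model tau n) w i :
  retype (retype M w i) w (type_of M w) = M.
Proof.
by apply: model_eqP => v; rewrite !type_of_retype; case: eqP => [->|].
Qed.

Lemma realizers_retype (tau : finType) (n : nat) (M : model tau n) w i :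
  type_of M w != i -> #|realizers (retype M w i) i| = #|realizers M i|.+1.
Proof.
move=> wi; have -> : realizers (retype M w i) i = w |: realizers M i.
  apply/setP => v; rewrite !inE type_of_retype.
  by have [] := eqVneq v w; rewrite ?eqxx.
by rewrite cardsU1 realizersE wi.
Qed.

Lemma realizers_retype_neq (tau : finType) (n : nat) (M : model tau n) w i k :
  k != i -> #|realizers (retype M w i) k|
            = #|realizers M k| - (type_of M w == k).
Proof.
move=> ki; have -> : realizers (retype M w i) k = realizers M k :\ w.
  apply/setP => v; rewrite !inE type_of_retype.
  by have [] := eqVneq v w; rewrite // eq_sym (negbTE ki).
by rewrite [X in _ = X - _](cardsD1 w) realizersE addKn.
Qed.

Definition crowded (tau : finType) (n d : nat) (M : model tau n) : {set 'I_n} :=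
  [set w | d < #|realizers M (type_of M w)|].

(** The points left out lie in types with at most [d] realizers each. *)
Lemma card_crowded (tau : finType) (n d : nat) (M : model tau n) :
  n - d * #|ptype tau| <= #|crowded d M|.
Proof.
have := cardsC (crowded d M); rewrite card_ord => cC.
suff : #|~: crowded d M| <= d * #|ptype tau| by lia.
have -> : ~: crowded d M
    = [set w | [pred i | #|realizers M i| <= d] (type_of M w)].
  by apply/setP => w; rewrite !inE /= -leqNgt.
rewrite card_type_pred mulnC -sum_nat_const big_mkcond /=.
by apply: leq_sum => i _; case: ifP.
Qed.

(** A crowded point of a model in the class of [nb] has a type [k] with
[nb k = d] and can be taken away without leaving the class; giving it the type
[i] therefore lands in the class of [nb'].  When [nb' i = d], the class of [nb']
puts no upper bound on the realizers of [i], but the models reached have exactly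
[nb' i] of them, so at most [d] points can be the one that was changed. *)
Lemma card_class_of_step (tau : finType) (n d : nat)
    (nb nb' : {ffun ptype tau -> nat}) i :
  (forall k, nb k <= d) -> nb i < d ->
  (forall k, nb' k = nb k + (k == i)) ->
  #|class_of n d nb| * (n - d * #|ptype tau|)
    <= #|class_of n d nb'| * (d * #|ptype tau|).
Proof.
move=> nb_le nbi nb'E.
have nb'_le k : nb' k <= d.
  by rewrite nb'E; case: eqP => [->|_]; have := nb_le k; lia.
pose E := [set x : model tau n * 'I_n
           | (x.1 \in class_of n d nb) && (x.2 \in crowded d x.1)].
pose F := [set y : model tau n * ('I_n * ptype tau)
  | [&& y.1 \in class_of n d nb', #|realizers y.1 i| <= d
      & y.2.1 \in realizers y.1 i]].
pose move_to_i (x : model tau n * 'I_n) :=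
  (retype x.1 x.2 i, (x.2, type_of x.1 x.2)).
have move_inj : injective move_to_i.
  move=> [M w] [N v] [] /= eqMN eq_w eq_t; rewrite -{v}eq_w in eqMN eq_t *.
  by rewrite -(retypeK M w i) eqMN eq_t retypeK.
have card_E : #|E| >= #|class_of n d nb| * (n - d * #|ptype tau|).
  rewrite -[#|E|]sum1_card (eq_bigl (fun x => (x.1 \in class_of n d nb)
    && (x.2 \in crowded d x.1))) => [|x]; last by rewrite inE.
  rewrite -(pair_big_dep (mem (class_of n d nb)) (fun M => mem (crowded d M))
    (fun _ _ => 1)) /= -sum_nat_const.
  by apply: leq_sum => M _; rewrite sum1_card card_crowded.
have card_F : #|F| <= #|class_of n d nb'| * (d * #|ptype tau|).
  rewrite -[#|F|]sum1_card (eq_bigl (fun y => (y.1 \in class_of n d nb')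
    && ((#|realizers y.1 i| <= d) && (y.2.1 \in realizers y.1 i)))) => [|y];
    last by rewrite inE.
  rewrite -(pair_big_dep (mem (class_of n d nb'))
    (fun N x => (#|realizers N i| <= d) && (x.1 \in realizers N i))
    (fun _ _ => 1)) /= -sum_nat_const.
  apply: leq_sum => N _.
  have [le_d /=|_ /=] := leqP #|realizers N i| d; last by rewrite big_pred0_eq.
  rewrite sum1dep_card (_ : finset _ = setX (realizers N i) setT).
    by rewrite cardsX cardsT leq_mul2r le_d orbT.
  by apply/setP => x; rewrite !inE andbT.
suff sub_EF : [set move_to_i x | x in E] \subset F.
  by have := subset_leq_card sub_EF; rewrite card_imset //; lia.
apply/subsetP => y /imsetP [[M w]]; rewrite inE /= in_class_of // inE.
move=> /andP [/forallP M_in w_crowded] -> {y}; rewrite inE /=.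
have wi : type_of M w != i.
  by apply: contraTneq w_crowded => ->; have /eqP := M_in i; lia.
have Mi := realizers_retype wi; have /eqP Mi' := M_in i.
apply/and3P; split; last by rewrite realizersE type_of_retype eqxx.
  rewrite in_class_of //; apply/forallP => k; rewrite nb'E.
  have [->|ki] := eqVneq k i; first by rewrite Mi; lia.
  rewrite (realizers_retype_neq _ _ ki) addn0; have /eqP := M_in k.
  by move: w_crowded; have [->|_] := eqVneq (type_of M w) k; lia.
by rewrite Mi; lia.
Qed.

Lemma card_class_of_lt (tau : finType) (n d : nat)
    (nb nb' : {ffun ptype tau -> nat}) j :
  (forall i, nb i <= nb' i <= d) -> nb j = d -> nb <> nb' ->
  (d * #|ptype tau|).*2 < n -> #|class_of n d nb| < #|class_of n d nb'|.
Proof.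
move=> le_nb nbj neq_nb n_gt.
have [s le_s] := ubnP (\sum_i (nb' i - nb i)).
elim: s nb le_s le_nb nbj neq_nb => // s IHs nb le_s le_nb nbj neq_nb.
have nb_le i : nb i <= d by have := le_nb i; lia.
have [i lt_i] : exists i, nb i < nb' i.
  apply/existsP; apply: contra_notT neq_nb; rewrite negb_exists => /forallP ge_nb.
  apply/ffunP => i; have /andP[le_i _] := le_nb i.
  by apply: anti_leq; rewrite le_i leqNgt; apply: ge_nb.
pose nb1 : {ffun ptype tau -> nat} := [ffun k => nb k + (k == i)].
have nb1E k : nb1 k = nb k + (k == i) by rewrite ffunE.
have nbi : nb i < d by have := le_nb i; lia.
have lt1 : #|class_of n d nb| < #|class_of n d nb1|.
  have := card_class_of_step n nb_le nbi nb1E.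
  have n_ge : d * #|ptype tau| <= n by lia.
  have := class_of_gt0 nb_le nbj n_ge.
  have gt_dt : d * #|ptype tau| < n - d * #|ptype tau| by lia.
  move: gt_dt; move: (d * _) (n - _) #|_| #|_| => a b x y; nia.
have [<- //|neq1] := eqVneq nb1 nb'; apply: (ltn_trans lt1); apply: IHs.
- have : \sum_k (nb' k - nb1 k) < \sum_k (nb' k - nb k); last first.
    by move=> lt_sum; apply: leq_trans lt_sum _; rewrite -ltnS.
  rewrite (bigD1 i) //= [ltnRHS](bigD1 i) //= nb1E eqxx -addSn.
  apply: leq_add; first by lia.
  by apply: leq_sum => k _; rewrite nb1E leq_sub2l // leq_addr.
- by move=> k; rewrite nb1E; have := le_nb k; have [->|_] := eqVneq k i; lia.
- rewrite nb1E; have [ji|_] := eqVneq j i; last by rewrite addn0.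
  by move: nbi; rewrite -ji nbj ltnn.
- by apply/eqP.
Qed.

(** * Lower bound on the size of a defining formula *)

Fixpoint prop_holds (tau : finType) (pi : ptype tau) (psi : prop_form tau) :
  bool :=
  match psi with
  | PPos p => pi p
  | PNeg p => ~~ pi p
  | PAnd a b => prop_holds pi a && prop_holds pi b
  | POr a b => prop_holds pi a || prop_holds pi b
  end.

Lemma prop_satE (tau : finType) (n : nat) (M : model tau n) w psi :
  prop_sat M w psi = prop_holds (type_of M w) psi.
Proof.
by elim: psi => [p|p|a IHa b IHb|a IHa b IHb] /=; rewrite ?IHa ?IHb ?ffunE.
Qed.

Definition atom (tau : finType) : Type := (modality * prop_form tau)%type.

(** The boxes count the points falsifying their argument, so that for all four
prefixes the truth of an atom is a test on the number of points in this set of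
types. *)
Definition counted (tau : finType) (a : atom tau) : {set ptype tau} :=
  match a.1 with
  | DiamondGe _ | DiamondEq _ => [set i | prop_holds i a.2]
  | BoxLt _ | BoxNe _ => [set i | ~~ prop_holds i a.2]
  end.

Definition count_test (q : modality) (c : nat) : bool :=
  match q with
  | DiamondGe k => k <= c
  | BoxLt k => ~~ (k <= c)
  | DiamondEq k => c == k
  | BoxNe k => c != k
  end.

(** An equality test with [k] costs [k.+1] exactly so that this holds: from the cost
on, the count exceeds [k]. *)
Lemma count_test_saturates q c c' :
  modality_cost q <= c -> modality_cost q <= c' ->
  count_test q c = count_test q c'.
Proof. by case: q => k /=; lia. Qed.

Definition atom_sat (tau : finType) (n : nat) (M : model tau n) (a : atom tau) :=
  modality_sat a.1 [set v | prop_sat M v a.2].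

Lemma atom_satE (tau : finType) (n : nat) (M : model tau n) (a : atom tau) :
  atom_sat M a = count_test a.1 (\sum_(i in counted a) #|realizers M i|).
Proof.
case: a => q psi; rewrite /atom_sat /=.
have -> : \sum_(i in counted (q, psi)) #|realizers M i|
    = #|[set v | type_of M v \in counted (q, psi)]|.
  by rewrite (card_type_pred M (mem (counted (q, psi)))).
case: q => k /=; try congr (~~ _); congr (_ _ _);
  by apply: eq_card => v; rewrite !inE /= ?prop_satE.
Qed.

Fixpoint atoms (tau : finType) (phi : gmlu tau) : seq (atom tau) :=
  match phi with
  | GBase q psi => [:: (q, psi)]
  | GAnd a b | GOr a b => atoms a ++ atoms b
  | GMod _ a => atoms a
  end.

Lemma sum_atoms_le_size (tau : finType) (phi : gmlu tau) :
  \sum_(a <- atoms phi) modality_cost a.1 <= gmlu_size phi.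
Proof.
elim: phi => [q psi|a IHa b IHb|a IHa b IHb|q a IHa] /=.
- by rewrite big_seq1 leq_addl.
- by rewrite big_cat /= (leq_trans (leq_add IHa IHb)) // leq_addr.
- by rewrite big_cat /= (leq_trans (leq_add IHa IHb)) // leq_addr.
- exact: leq_trans IHa (leq_addr _ _).
Qed.

(** A prefix applied to a formula sees only its set of satisfying points, so two
models with the same domain that agree on the atoms agree on the formula. *)
Lemma gmlu_sat_atoms (tau : finType) (n d : nat) (M N : model tau n) phi :
  in_gmlu_d d phi ->
  ~~ has (fun a => (modality_cost a.1 <= d) && (atom_sat M a != atom_sat N a))
         (atoms phi) ->
  gmlu_sat M ^~ phi =1 gmlu_sat N ^~ phi.
Proof.
elim: phi => [q psi|a IHa b IHb|a IHa b IHb|q a IHa] /=.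
- by rewrite orbF => -> /=; rewrite negbK => /eqP eqMN w.
- move=> /andP[da db]; rewrite has_cat negb_or => /andP[ha hb] w.
  by rewrite /= (IHa da ha w) (IHb db hb w).
- move=> /andP[da db]; rewrite has_cat negb_or => /andP[ha hb] w.
  by rewrite /= (IHa da ha w) (IHb db hb w).
- move=> /andP[_ da] ha w /=; congr modality_sat.
  by apply/setP => v; rewrite !inE; apply: IHa.
Qed.

(** The two models to be separated are the concentrated one and the one obtained
by moving a point from [i] to [j].  An atom counting [j] has a count of at least
[d] in both and cannot tell them apart; neither can one that counts neither type.
If the total of [nb] over the counted set exceeded the cost, both counts would be
in the range where the test is constant. *)
Lemma separating_atom (tau : finType) (n d : nat) (nb : {ffun ptype tau -> nat})
    phi i j :
  (forall k, nb k <= d) -> nb j = d -> d * #|ptype tau| <= n ->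
  in_gmlu_d d phi -> defines phi (class_of n d nb) ->
  i != j -> 0 < nb i ->
  has (fun a => [&& j \notin counted a, i \in counted a
                  & \sum_(k in counted a) nb k <= modality_cost a.1]) (atoms phi).
Proof.
move=> nb_le nbj n_ge phi_d def_phi ij nbi.
have sum_le := leq_trans (sum_le_dt nb_le) n_ge.
pose m := concentrated n nb j.
pose m' k := if k == j then (m j).+1 else if k == i then (nb i).-1 else nb k.
have m_j : d <= m j.
  rewrite /m /concentrated eqxx; move: sum_le; rewrite (bigD1 j) //= nbj.
  by move: (\sum_(_ | _) _) => r; lia.
have m_neq k : k != j -> m k = nb k by rewrite /m /concentrated => /negbTE ->.
have sum_m := sum_concentrated j sum_le.
have sum_m' : \sum_k m' k = n.
  rewrite -[RHS]sum_m (bigD1 j) //= [RHS](bigD1 j) //=.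
  rewrite (bigD1 i) //= [in RHS](bigD1 i) //= -/m /m'.
  rewrite eqxx (negbTE ij) eqxx (m_neq i ij).
  rewrite (eq_bigr m) => [|k /andP[kj ki]].
    by move: (m j) (\sum_(_ | _) _) => x r; lia.
  by rewrite (negbTE kj) (negbTE ki) m_neq.
have [M cM] := model_with_counts sum_m.
have [N cN] := model_with_counts sum_m'.
have M_in : M \in class_of n d nb.
  rewrite in_class_of //; apply/forallP => k; rewrite cM.
  have [->|kj] := eqVneq k j; first by rewrite nbj; apply/eqP/minn_idPr.
  by have := nb_le k; have := m_neq k kj; rewrite /m; lia.
have N_notin : N \notin class_of n d nb.
  rewrite in_class_of // negb_forall; apply/existsP; exists i.
  by rewrite cN /m' (negbTE ij) eqxx; have := nb_le i; lia.
have [] := boolP (has (fun a => (modality_cost a.1 <= d)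
                     && (atom_sat M a != atom_sat N a)) (atoms phi)); last first.
  move=> /(gmlu_sat_atoms phi_d) eq_sat; case/negP: N_notin.
  apply/def_phi/forallP => w; rewrite -eq_sat.
  by have /def_phi/forallP := M_in.
apply: sub_has => a /andP[cost_le]; rewrite !atom_satE.
rewrite (eq_bigr m (fun k _ => cM k)).
rewrite [X in _ != count_test _ X](eq_bigr m' (fun k _ => cN k)).
have [ja|ja] := boolP (j \in counted a) => differ.
  case/eqP: differ; apply: count_test_saturates; apply: (leq_trans cost_le).
    by rewrite (bigD1 j) //=; lia.
  by rewrite (bigD1 j) //= /m' eqxx; lia.
have neq_j k : k \in counted a -> k != j by move=> ka; apply: contraNneq ja => <-.
have sum_mE : \sum_(k in counted a) m k = \sum_(k in counted a) nb k.
  by apply: eq_bigr => k ka; rewrite m_neq // neq_j.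
rewrite sum_mE in differ; have [ia|ia] := boolP (i \in counted a); last first.
  case/eqP: differ; congr count_test; apply: eq_bigr => k ka.
  rewrite /m' (negbTE (neq_j k ka)); case: eqP => // ki.
  by rewrite -ki ka in ia.
rewrite /= leqNgt; apply/negP => cost_lt.
case/eqP: differ; apply: count_test_saturates; first exact: ltnW.
suff sum_m'E : (\sum_(k in counted a) m' k).+1 = \sum_(k in counted a) nb k.
  by rewrite -ltnS sum_m'E.
rewrite (bigD1 i) //= [RHS](bigD1 i) //= -addSn; congr (_ + _).
  by rewrite /m' (negbTE ij) eqxx prednK.
apply: eq_bigr => k /andP[ka ki].
by rewrite /m' (negbTE (neq_j k ka)) (negbTE ki).
Qed.

(** As soon as some coordinate equals [d], a type [i] fails to be essential only
if [i] is the one coordinate with that value. *)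
Definition essential (tau : finType) (d : nat) (nb : {ffun ptype tau -> nat}) :
  pred (ptype tau) := [pred i | [exists k, (k != i) && (nb k == d)]].

(** The atoms not counting [j] pay for the types other than [j]: each useful one
costs at least the total of [nb] over the set it counts, and these sets cover
every type with a nonzero coordinate.  An atom counting [j] pays for [j] when [j]
is essential. *)
Lemma size_lower_bound (tau : finType) (n d : nat)
    (nb : {ffun ptype tau -> nat}) phi j :
  (forall k, nb k <= d) -> nb j = d -> 0 < d -> d * #|ptype tau| <= n ->
  in_gmlu_d d phi -> defines phi (class_of n d nb) ->
  \sum_(i | essential d nb i) nb i <= gmlu_size phi.
Proof.
move=> nb_le nbj d_gt0 n_ge phi_d def_phi.
apply: leq_trans (sum_atoms_le_size phi).
have sep := separating_atom nb_le _ n_ge phi_d def_phi.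
rewrite (bigID (fun a : atom tau => j \in counted a)) /= (bigID (pred1 j)) /=.
apply: leq_add.
  have [/existsP[k /andP[kj /eqP nbk]]|/negbTE ness] := boolP (essential d nb j).
    rewrite (big_pred1 j) => [|l]; last first.
      rewrite /= andbC; case: eqP => //= ->.
      by apply/existsP; exists k; rewrite kj nbk eqxx.
    have nbj_gt0 : 0 < nb j by rewrite nbj.
    (* The roles are exchanged: [k] takes the remaining points and [j] has [d]. *)
    rewrite eq_sym in kj; move: (sep j k nbk kj nbj_gt0).
    elim: (atoms phi) => //= a s IHs; rewrite big_cons.
    case/orP => [/and3P[_ ja le_cost]|/IHs le_s].
      rewrite ja; apply: leq_trans (leq_addr _ _); apply: leq_trans le_cost.
      by rewrite (bigD1 j) //= leq_addr.
    by case: ifP => // _; apply: leq_trans le_s (leq_addl _ _).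
  by rewrite big_pred0 // => l /=; apply/negbTE/negP => /andP[+ /eqP lj];
    rewrite lj ness.
pose useful (a : atom tau) :=
  (j \notin counted a) && (\sum_(k in counted a) nb k <= modality_cost a.1).
apply: (@leq_trans (\sum_(a <- atoms phi | useful a) \sum_(k in counted a) nb k)).
  have -> : \sum_(a <- atoms phi | useful a) \sum_(k in counted a) nb k
      = \sum_k \sum_(a <- atoms phi | useful a && (k \in counted a)) nb k.
    rewrite (exchange_big_dep predT) //=.
  rewrite big_mkcond /=; apply: leq_sum => i _.
  case: ifP => // /andP[_ ij].
  have [->//|nbi] := posnP (nb i).
  have := sep i j nbj ij nbi.
  elim: (atoms phi) => //= a s IHs; rewrite big_cons /useful.
  case/orP => [/and3P[-> -> ->]|/IHs le_s]; first exact: leq_addr.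
  by case: ifP => // _; apply: leq_trans le_s (leq_addl _ _).
rewrite big_mkcond [leqRHS]big_mkcond /=; apply: leq_sum => a _.
by rewrite /useful; case: (j \notin counted a) => //=; case: ifP.
Qed.

(** * Upper bound on the description complexity *)

Lemma literal_conjunction (tau : finType) (pi : ptype tau) : 0 < #|tau| ->
  exists psi : prop_form tau, (prop_size psi).+1 = 2 * #|tau|
    /\ forall rho, prop_holds rho psi = (rho == pi).
Proof.
move=> tau_gt0.
have conj_seq (s : seq tau) : s != [::] ->
    exists psi : prop_form tau, (prop_size psi).+1 = 2 * size s
      /\ forall rho, prop_holds rho psi = all (fun p => rho p == pi p) s.
  elim: s => // p s IHs _.
  pose lit := if pi p then PPos p else PNeg p.
  have lit_holds rho : prop_holds rho lit = (rho p == pi p).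
    by rewrite /lit; case: (pi p) => /=; case: (rho p).
  have lit_size : prop_size lit = 1 by rewrite /lit; case: ifP.
  have [->|/IHs[psi [psi_size psi_holds]]] := eqVneq s [::].
    by exists lit; split=> [|rho]; rewrite ?lit_size //= lit_holds andbT.
  exists (PAnd lit psi); split=> [|rho] /=; last by rewrite lit_holds psi_holds.
  by rewrite lit_size; lia.
have [|psi [psi_size psi_holds]] := conj_seq (enum tau).
  by rewrite -size_eq0 -cardE -lt0n.
exists psi; rewrite psi_size -cardE; split=> // rho; rewrite psi_holds.
apply/allP/eqP => [eq_pi|-> //]; apply/ffunP => p; apply/eqP/eq_pi.
by rewrite mem_enum.
Qed.

Lemma count_formula (tau : finType) (d c : nat) (pi : ptype tau) :
  0 < #|tau| -> c <= d ->
  exists phi : gmlu tau,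
    [/\ in_gmlu_d d phi, gmlu_size phi <= c + 2 * #|tau|
      & forall n (M : model tau n) w,
          gmlu_sat M w phi = (minn #|realizers M pi| d == c)].
Proof.
move=> tau_gt0 c_le; have [psi [psi_size psi_holds]] := literal_conjunction pi tau_gt0.
have realE n (M : model tau n) : [set v | prop_sat M v psi] = realizers M pi.
  by apply/setP => v; rewrite !inE prop_satE psi_holds.
have [c_lt|c_ge] := ltnP c d.
  exists (GBase (DiamondEq c) psi); split=> [||n M w] //=; first by rewrite -psi_size; lia.
  by rewrite realE; move: #|_| => x; apply/eqP/eqP; lia.
have -> : c = d by apply/eqP; rewrite eqn_leq c_le.
exists (GBase (DiamondGe d) psi); split=> [||n M w] //=; first by rewrite -psi_size; lia.
by rewrite realE; apply/idP/eqP => /minn_idPr.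
Qed.

Lemma count_conjunction (tau : finType) (d : nat) (nb : ptype tau -> nat)
    (s : seq (ptype tau)) :
  0 < #|tau| -> (forall i, nb i <= d) -> s != [::] ->
  exists phi : gmlu tau,
    [/\ in_gmlu_d d phi,
        (gmlu_size phi).+1 <= \sum_(i <- s) nb i + size s * (2 * #|tau| + 1)
      & forall n (M : model tau n) w,
          gmlu_sat M w phi = all (fun i => minn #|realizers M i| d == nb i) s].
Proof.
move=> tau_gt0 nb_le; elim: s => // i s IHs _.
have [phi [phi_d phi_size phi_sat]] := count_formula i tau_gt0 (nb_le i).
have [->|/IHs[chi [chi_d chi_size chi_sat]]] := eqVneq s [::].
  exists phi; split=> // [|n M w]; last by rewrite phi_sat /= andbT.
  by rewrite big_seq1 mul1n addnA addn1 ltnS.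
exists (GAnd phi chi); split=> [||n M w] /=; first by rewrite phi_d.
  rewrite big_cons mulSn addnACA [_ + 1 in leqLHS]addn1 -addSn -addnS.
  by apply: leq_add => //; rewrite addnA addn1 ltnS.
by rewrite phi_sat chi_sat.
Qed.

(** If [i] is inessential, all other coordinates are below [d] and hence count
their types exactly; what remains is at least [n] minus the other coordinates,
which is enough for [i]. *)
Lemma in_class_of_essential (tau : finType) (n d : nat)
    (nb : {ffun ptype tau -> nat}) j (M : model tau n) :
  (forall i, nb i <= d) -> nb j = d -> d * #|ptype tau| <= n ->
  (M \in class_of n d nb)
    = all (fun i => minn #|realizers M i| d == nb i) (enum (essential d nb)).
Proof.
move=> nb_le nbj n_ge; rewrite in_class_of //.
apply/forallP/allP => [M_in i _|M_ess i]; first exact: M_in.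
have [ess_i|ness_i] := boolP (i \in essential d nb).
  by apply: M_ess; rewrite mem_enum.
have nb_lt k : k != i -> nb k < d.
  rewrite ltn_neqAle nb_le andbT => ki; apply: contra ness_i => nbk.
  by rewrite inE /=; apply/existsP; exists k; rewrite ki.
have ij : i = j by apply: contra_eq nbj; rewrite eq_sym => /nb_lt; lia.
have others k : k != i -> #|realizers M k| = nb k.
  move=> ki; have lt_k := nb_lt k ki.
  have /M_ess : k \in enum (essential d nb).
    rewrite mem_enum inE; apply/existsP; exists i.
    by rewrite eq_sym ki ij nbj eqxx.
  by move: lt_k; lia.
rewrite ij nbj; apply/eqP/minn_idPr; rewrite -ij.
have : \sum_k nb k <= \sum_k #|realizers M k|.
  by rewrite sum_realizers (leq_trans (sum_le_dt nb_le)).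
by rewrite (bigD1 i) //= [leqRHS](bigD1 i) //= (eq_bigr _ others) leq_add2r ij nbj.
Qed.

Lemma definable_upper_bound (tau : finType) (n d : nat)
    (nb : {ffun ptype tau -> nat}) j :
  0 < #|tau| -> 0 < d -> (forall i, nb i <= d) -> nb j = d ->
  d * #|ptype tau| <= n ->
  exists2 s, definable_in_size d (class_of n d nb) s
           & s <= \sum_(i | essential d nb i) nb i + c_tau tau.
Proof.
move=> tau_gt0 d_gt0 nb_le nbj n_ge.
have card_ptype : #|ptype tau| = 2 ^ #|tau| by rewrite card_ffun card_bool.
have card_gt1 : 1 < #|ptype tau|.
  by rewrite card_ptype -{1}(expn0 2) ltn_exp2l.
have [|phi [phi_d phi_size phi_sat]] :=
    count_conjunction (s := enum (essential d nb)) tau_gt0 nb_le.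
  have [k kj] : exists k, k != j.
    apply/existsP; rewrite -negb_forall; apply: contraL card_gt1 => /forallP all_j.
    rewrite -leqNgt; apply/fintype_le1P => x y.
    by rewrite (eqP (all_j x)) (eqP (all_j y)).
  rewrite -size_eq0 -cardE -lt0n; apply/card_gt0P; exists k.
  by rewrite inE; apply/existsP; exists j; rewrite eq_sym kj nbj eqxx.
exists (gmlu_size phi); first exists phi; first split=> // M.
  rewrite (in_class_of_essential M nb_le nbj n_ge).
  have n_gt0 : 0 < n by apply: leq_trans n_ge; rewrite muln_gt0 d_gt0 ltnW.
  split=> [/forallP/(_ (Ordinal n_gt0))|M_ess]; first by rewrite phi_sat.
  by apply/forallP => w; rewrite phi_sat.
move: phi_size; rewrite big_enum -cardE /c_tau -card_ptype.
have := max_card (mem (essential d nb)).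
move: #|_| #|_| (\sum_(_ | _) _) => x y r.
nia.
Qed.

(** Definability excludes the default value [0] of the complexity. *)
Lemma complexity_attained (tau : finType) (n d : nat) (A : {set model tau n}) s :
  definable_in_size d A s ->
  definable_in_size d A (description_complexity d A)
  /\ description_complexity d A <= s.
Proof.
move=> def_s; rewrite /description_complexity; case: pselect => [ex|[]]; last first.
  by exists s; apply/asboolP.
by case: ex_minnP => m /asboolP def_m min_m; split=> //; apply/min_m/asboolP.
Qed.

(** * Comparison of two tuples *)

(** Types essential for [nb] are essential for [nb'], and a type inessential for
[nb'] is the [j] with [nb j = d], where the two tuples agree. *)
Lemma essential_sum_gap (tau : finType) (d : nat)
    (nb nb' : {ffun ptype tau -> nat}) j :
  (forall i, nb i <= nb' i <= d) -> nb j = d ->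
  \sum_(i | essential d nb i) nb i + \sum_i (nb' i - nb i)
    <= \sum_(i | essential d nb' i) nb' i.
Proof.
move=> le_nb nbj; rewrite big_mkcond [leqRHS]big_mkcond -big_split /=.
apply: leq_sum => i _; have le_i := le_nb i.
have [ess'|ness'] := boolP (essential d nb' i); first by case: ifP; lia.
have nb_lt k : k != i -> nb k < d.
  move=> ki; have := le_nb k; suff : nb' k != d by lia.
  by apply: contra ness' => nbk; apply/existsP; exists k; rewrite ki.
have ij : i = j by apply: contra_eq nbj; rewrite eq_sym => /nb_lt; lia.
rewrite ifF; first by move: le_i; rewrite ij nbj; lia.
apply/negbTE; rewrite negb_exists; apply/forallP => k.
by rewrite negb_and; case: eqVneq => //= /nb_lt; lia.
Qed.

Lemma class_of_lt (R : realType) (tau : finType) (n d : nat)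
    (nb nb' : {ffun ptype tau -> nat}) j :
  0 < #|tau| -> 0 < d -> (d * #|ptype tau|).*2 < n ->
  (forall i, nb i <= nb' i <= d) -> nb j = d ->
  c_tau tau < \sum_i (nb' i - nb i) ->
  (boltzmann_entropy R (class_of n d nb) < boltzmann_entropy R (class_of n d nb'))%R
  /\ description_complexity d (class_of n d nb)
       < description_complexity d (class_of n d nb').
Proof.
move=> tau_gt0 d_gt0 n_gt le_nb nbj gap.
have n_ge : d * #|ptype tau| <= n by lia.
have nb_le i : nb i <= d by have := le_nb i; lia.
have nb'_le i : nb' i <= d by have := le_nb i; lia.
have nb'j : nb' j = d by have := le_nb j; lia.
split.
  have neq : nb <> nb'.
    by move=> eq_nb; move: gap; rewrite eq_nb big1 // => i _; rewrite subnn.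
  have lt_card := card_class_of_lt le_nb nbj neq n_gt.
  have gt0 := class_of_gt0 nb_le nbj n_ge.
  rewrite /boltzmann_entropy ltr_pM2r; last by rewrite invr_gt0 ln_gt0 // ltr1n.
  by rewrite ltr_ln ?posrE ?ltr_nat ?ltr0n // (leq_trans gt0) // ltnW.
have [s def_s s_le] := definable_upper_bound tau_gt0 d_gt0 nb_le nbj n_ge.
have [s' def_s' _] := definable_upper_bound tau_gt0 d_gt0 nb'_le nb'j n_ge.
have [_ C_le] := complexity_attained def_s.
have [[phi [phi_d def_phi <-]] _] := complexity_attained def_s'.
apply: leq_ltn_trans (leq_trans C_le s_le) _.
apply: leq_trans (size_lower_bound nb'_le nb'j d_gt0 n_ge phi_d def_phi).
by apply: leq_trans (essential_sum_gap le_nb nbj); rewrite ltn_add2l.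
Qed.

Lemma admissible_full (tau : finType) (n d : nat) (nb : {ffun ptype tau -> nat}) :
  d * #|ptype tau| < n -> admissible n d nb -> exists j, nb j = d.
Proof.
move=> n_gt [nb_le _ [//|sum_n]].
by have := sum_le_dt nb_le; rewrite sum_n leqNgt n_gt.
Qed.

Theorem corollary4p9 (R : realType) (tau : finType) (d : nat) :
  0 < #|tau| -> 0 < d ->
  exists n0 : nat, forall n : nat, n0 <= n ->
  forall nb nb' : {ffun ptype tau -> nat},
    admissible n d nb -> admissible n d nb' ->
    nb <> nb' ->
    preceq_tau nb nb' \/ preceq_tau nb' nb ->
    ((boltzmann_entropy R (class_of n d nb) < boltzmann_entropy R (class_of n d nb'))%R
     <->
     (description_complexity d (class_of n d nb)
        < description_complexity d (class_of n d nb'))%N).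
Proof.
move=> tau_gt0 d_gt0; exists (d * #|ptype tau|).*2.+1 => n n_gt nb nb' adm adm' neq.
have n_gt1 : d * #|ptype tau| < n by lia.
have [j nbj] := admissible_full n_gt1 adm.
have [j' nb'j'] := admissible_full n_gt1 adm'.
have [nb_le _ _] := adm; have [nb'_le _ _] := adm'.
case=> -[le_nb [eq_nb|gap]]; [by case: neq| |by case: neq|].
  have le_nb_d i : nb i <= nb' i <= d by rewrite le_nb nb'_le.
  by have [] := class_of_lt R tau_gt0 d_gt0 n_gt le_nb_d nbj gap.
have le_nb_d i : nb' i <= nb i <= d by rewrite le_nb nb_le.
have [lt_H lt_C] := class_of_lt R tau_gt0 d_gt0 n_gt le_nb_d nb'j' gap.
split=> lt; exfalso; first by move: (lt_trans lt lt_H); rewrite ltxx.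
by move: (ltn_trans lt lt_C); rewrite ltnn.
Qed.
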